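(* Let $\Omega\subset\mathbb{R}^n$ be a domain, let $\beta\in[0,2]$, and let $f$ be a real-valued function, written $f(|x|,t)$ for $x\in\Omega$, $t\in\mathbb{R}$, such that $$\sup_{(x,t)\in\Omega\times I} f(|x|,t)<\infty\quad\text{for every compact set } I\subset\mathbb{R}.$$ Let $c_1,c_2\ge 0$ and $m\in(0,3-\beta]$, and let $v$ be a bounded viscosity solution of $$\Delta_\infty^\beta v\ \ge\ -c_1|\nabla v|^m-c_2 f(|x|,v)\quad\text{in }\Omega .$$ Then $v$ is locally Lipschitz in $\Omega$, with Lipschitz constant depending on $c_1,c_2$, $\|v\|_{L^\infty(\Omega)}$ and $\|f_0\|_{L^\infty(\Omega)}:=\sup_{x\in\Omega} f(|x|,v(x))$.
   Context: For $\beta\in[0,2]$, $\Delta_\infty^\beta u=|\nabla u|^{-\beta}\langle D^2u\,\nabla u,\nabla u\rangle$; when $\beta<2$ this is read as $0$ at points where $\nabla u=0$. Viscosity solution of the inequality: $v$ is upper semicontinuous and, whenever $\varphi$ is $C^2$ and $v-\varphi$ has a local maximum at $x_0\in\Omega$ with $v(x_0)=\varphi(x_0)$, one has $\Delta_\infty^\beta\varphi(x_0)\ge -c_1|\nabla\varphi(x_0)|^m-c_2f(|x_0|,v(x_0))$. If $\beta=2$ and $\nabla\varphi(x_0)=0$, the term $\Delta_\infty^\beta\varphi(x_0)$ is replaced by the maximal eigenvalue $M(D^2\varphi(x_0))=\max_{|\xi|=1}\langle \xi,D^2\varphi(x_0)\xi\rangle$. *)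

(* Defs.v *)
From HB Require Import structures.
From mathcomp Require Import all_boot all_order all_algebra.
From mathcomp Require Import all_classical all_reals all_analysis.
Import Order.TTheory GRing.Theory Num.Theory.
Import numFieldNormedType.Exports.

Set Implicit Arguments.
Unset Strict Implicit.
Unset Printing Implicit Defensive.

Local Open Scope classical_set_scope.
Local Open Scope ring_scope.

(* The library norm `|x| on 'rV[R]_n is the max norm, hence the Euclidean
   product and norm below.  Both norms induce the same topology, so open,
   connected, compact sets and limits are those of the library. *)
Definition edot {R : realType} {n : nat} (u v : 'rV[R]_n) : R :=
  \sum_(i < n) u 0 i * v 0 i.

Definition enorm {R : realType} {n : nat} (u : 'rV[R]_n) : R :=
  Num.sqrt (edot u u).

Definition is_domain {R : realType} {n : nat} (Omega : set 'rV[R]_n) : Prop :=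
  [/\ open Omega, connected Omega & Omega !=set0].

Definition partial {R : realType} {n : nat} (i : 'I_n) (phi : 'rV[R]_n -> R)
    : 'rV[R]_n -> R :=
  fun x => 'D_(delta_mx 0 i) phi x.

Definition grad {R : realType} {n : nat} (phi : 'rV[R]_n -> R) (x : 'rV[R]_n)
    : 'rV[R]_n :=
  \row_(i < n) partial i phi x.

Definition hess {R : realType} {n : nat} (phi : 'rV[R]_n -> R) (x : 'rV[R]_n)
    : 'M[R]_n :=
  \matrix_(i < n, j < n) partial j (partial i phi) x.

(* [Omega] is meant to be open: all first partial derivatives exist and are
   continuous in [Omega], which is equivalent to [phi] being C^1 there. *)
Definition C1_on {R : realType} {n : nat} (Omega : set 'rV[R]_n)
    (phi : 'rV[R]_n -> R) : Prop :=
  forall (x : 'rV[R]_n) (i : 'I_n), Omega x ->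
    derivable phi x (delta_mx 0 i) /\ {for x, continuous (partial i phi)}.

Definition C2_on {R : realType} {n : nat} (Omega : set 'rV[R]_n)
    (phi : 'rV[R]_n -> R) : Prop :=
  C1_on Omega phi /\ forall i : 'I_n, C1_on Omega (partial i phi).

Definition usc_on {R : realType} {n : nat} (Omega : set 'rV[R]_n)
    (v : 'rV[R]_n -> R) : Prop :=
  forall (x : 'rV[R]_n) (a : R), Omega x -> v x < a ->
    \forall y \near x, v y < a.

(* For 0 < n the supremum is a maximum, by compactness of the unit sphere. *)
Definition max_eig {R : realType} {n : nat} (X : 'M[R]_n) : R :=
  sup [set edot xi (xi *m X) | xi in [set xi : 'rV[R]_n | enorm xi = 1]].

(* The operator Delta_oo^beta as a function of the gradient [p] and of the
   Hessian [X], including its reading at [p = 0].  Vectors are rows, so that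
   [p *m X] stands for the (symmetric) matrix [X] applied to [p]. *)
Definition inf_lap {R : realType} {n : nat} (beta : R) (p : 'rV[R]_n)
    (X : 'M[R]_n) : R :=
  if p == 0 then (if beta == 2 then max_eig X else 0)
  else enorm p `^ (- beta) * edot (p *m X) p.

(* Only the values of [v] in [Omega] matter, [Omega] being open. *)
Definition viscosity_solution {R : realType} {n : nat} (Omega : set 'rV[R]_n)
    (beta m c1 c2 : R) (f : R -> R -> R) (v : 'rV[R]_n -> R) : Prop :=
  usc_on Omega v /\
  forall (phi : 'rV[R]_n -> R) (x0 : 'rV[R]_n),
    C2_on Omega phi -> Omega x0 ->
    (\forall x \near x0, v x - phi x <= v x0 - phi x0) ->
    v x0 = phi x0 ->
    - c1 * enorm (grad phi x0) `^ m - c2 * f (enorm x0) (v x0)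
      <= inf_lap beta (grad phi x0) (hess phi x0).

Definition sup_norm {R : realType} {n : nat} (Omega : set 'rV[R]_n)
    (v : 'rV[R]_n -> R) : R :=
  sup [set `|v x| | x in Omega].

Definition f0_norm {R : realType} {n : nat} (Omega : set 'rV[R]_n)
    (f : R -> R -> R) (v : 'rV[R]_n -> R) : R :=
  sup [set f (enorm x) (v x) | x in Omega].

Definition lipschitz_with {R : realType} {n : nat} (K : set 'rV[R]_n) (L : R)
    (v : 'rV[R]_n -> R) : Prop :=
  forall x y : 'rV[R]_n, K x -> K y -> `|v x - v y| <= L * enorm (x - y).

(* Main.v *)
(* Fix x in a compact K and a radius r such that the r-neighbourhood of K stays
   in Omega.  With s = |y - x|, the barrier w(y) = v(x) + A s - B s^2 satisfies
   Delta_oo^beta w = - 2 B g^(2 - beta), where g = A - 2 B s is its slope.  For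
   2 B = c1 A + c2 F + 1, r small with respect to 1 / c1 and A large, 1 <= g <= A
   holds for s <= r, so w violates the inequality satisfied by v away from x
   (this uses g^m <= A g^(2 - beta), i.e. m <= 3 - beta); moreover w >= v on the
   sphere s = r.  Hence v - w is maximal over the ball at x or on the sphere,
   and v(y) - v(x) <= A s.  None of the constants involves beta or m.

   Test functions must be C^2 in all of Omega, which w is not at x.  It is
   replaced by a polynomial in s^2 touching w from above at the contact point. *)
Require Import Defs.
From mathcomp Require Import all_boot all_order all_algebra.
From mathcomp Require Import all_classical all_reals all_analysis.
From mathcomp Require Import ring lra.
Import Order.TTheory GRing.Theory Num.Theory.
Import numFieldNormedType.Exports.
Local Open Scope classical_set_scope.
Local Open Scope ring_scope.
Set Implicit Arguments.
Unset Strict Implicit.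
Unset Printing Implicit Defensive.

(** * Derivatives of the squared Euclidean distance and of polynomials in it *)

Lemma is_derive_coord {R : realType} {n : nat} (i : 'I_n) (y u : 'rV[R]_n) :
  is_derive y u (fun z : 'rV[R]_n => z 0 i) (u 0 i).
Proof.
have lim_quot : h^-1 *: (((fun z : 'rV[R]_n => z 0 i) \o shift y) (h *: u) - y 0 i)
    @[h --> 0^'] --> u 0 i.
  apply: cvg_near_cst; near=> h.
  rewrite /= !mxE addrK /GRing.scale /= mulrA mulVf ?mul1r //.
  by near: h; exact: nbhs_dnbhs_neq.
by apply: DeriveDef; [apply/cvg_ex; exists (u 0 i) | exact: cvg_lim].
Unshelve. all: by end_near. Qed.

Definition sqdist {R : realType} {n : nat} (x y : 'rV[R]_n) : R :=
  edot (y - x) (y - x).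

Lemma sqdist_sum {R : realType} {n : nat} (x : 'rV[R]_n) :
  sqdist x = \sum_(i < n) (fun y : 'rV[R]_n => y 0 i - x 0 i) ^+ 2.
Proof.
apply/funext => y; rewrite /sqdist /edot fct_sumE.
by apply: eq_bigr => i _; rewrite !mxE.
Qed.

Lemma is_derive_coordB {R : realType} {n : nat} (i : 'I_n) (x y u : 'rV[R]_n) :
  is_derive y u (fun z : 'rV[R]_n => z 0 i - x 0 i) (u 0 i).
Proof.
apply: is_derive_eq; last exact: subr0.
exact: is_deriveB (is_derive_coord i y u) (is_derive_cst (x 0 i) y u).
Qed.

Lemma is_derive_sqdist {R : realType} {n : nat} (x y u : 'rV[R]_n) :
  is_derive y u (sqdist x) (2 * edot (y - x) u).
Proof.
rewrite sqdist_sum; apply: is_derive_eq.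
  apply: is_derive_sum => i;  apply: (is_deriveX 2).
  exact: is_derive_coordB.
rewrite /edot mulr_sumr; apply: eq_bigr => i _.
by rewrite !mxE /= expr1 mulrA.
Qed.

Lemma continuous_coordB {R : realType} {n : nat} (i : 'I_n) (x : 'rV[R]_n) :
  continuous (fun z : 'rV[R]_n => z 0 i - x 0 i).
Proof.
move=> y; apply: (@continuousB _ _ _ (fun z : 'rV[R]_n => z 0 i)).
  exact: coord_continuous.
exact: cst_continuous.
Qed.

Lemma continuous_sqdist {R : realType} {n : nat} (x : 'rV[R]_n) :
  continuous (sqdist x).
Proof.
rewrite sqdist_sum; elim/big_ind: _ => [|f g cf cg|i _] y.
- exact: cst_continuous.
- exact: (continuousD (cf y) (cg y)).
- exact: (continuousM (@continuous_coordB _ _ i x y) (@continuous_coordB _ _ i x y)).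
Qed.

Lemma is_derive_horner_comp {R : realType} {V : normedModType R}
    (p : {poly R}) (T : V -> R) (y u : V) (dT : R) :
  is_derive y u T dT ->
  is_derive y u (fun z => p.[T z]) (p^`().[T y] * dT).
Proof.
move=> derT; elim/poly_ind: p => [|p c IHp].
  rewrite deriv0 horner0 mul0r.
  by under eq_fun do rewrite horner0; exact: is_derive_cst.
under eq_fun do rewrite hornerMXaddC.
apply: (is_derive_eq (is_deriveD (is_deriveM IHp derT) (is_derive_cst c y u))).
by rewrite addr0 derivMXaddC !hornerE /GRing.scale /=; ring.
Qed.

(** * Gradient, Hessian and operator value of radial polynomials *)

Section RadialPolynomial.
Context {R : realType} {n : nat}.
Implicit Types (x y : 'rV[R]_n) (p : {poly R}) (i j : 'I_n).

Lemma edot_delta x i : edot x (delta_mx 0 i) = x 0 i.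
Proof.
rewrite /edot (bigD1 i) //= mxE !eqxx mulr1 big1 ?addr0 // => j /negPf jNi.
by rewrite mxE jNi andbF mulr0.
Qed.

Lemma is_derive_radial p x y i :
  is_derive y (delta_mx 0 i) (fun z => p.[sqdist x z])
    (p^`().[sqdist x y] * (2 * (y 0 i - x 0 i))).
Proof.
apply: (is_derive_eq (is_derive_horner_comp p (is_derive_sqdist x y _))).
by rewrite edot_delta !mxE.
Qed.

Lemma partial_radial p x i :
  partial i (fun z => p.[sqdist x z]) =
  fun y => p^`().[sqdist x y] * (2 * (y 0 i - x 0 i)).
Proof. by apply/funext => y; exact: (@derive_val _ _ _ _ _ _ _ (is_derive_radial p x y i)). Qed.

Lemma is_derive_partial_radial p x y i j :
  is_derive y (delta_mx 0 j) (fun z => p^`().[sqdist x z] * (2 * (z 0 i - x 0 i)))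
    (p^`(2).[sqdist x y] * (2 * (y 0 j - x 0 j)) * (2 * (y 0 i - x 0 i))
     + p^`().[sqdist x y] * (2 * (i == j)%:R)).
Proof.
apply: (is_derive_eq (is_deriveM (is_derive_radial _ x y j)
  (is_deriveZ 2 (is_derive_coordB i x y (delta_mx 0 j))))).
by rewrite mxE eqxx /= /GRing.scale /= addrC; congr (_ + _); rewrite mulrC.
Qed.

Lemma partial2_radial p x i j :
  partial j (partial i (fun z => p.[sqdist x z])) =
  fun y => p^`(2).[sqdist x y] * (2 * (y 0 j - x 0 j)) * (2 * (y 0 i - x 0 i))
     + p^`().[sqdist x y] * (2 * (i == j)%:R).
Proof.
rewrite partial_radial; apply/funext => y.
exact: (@derive_val _ _ _ _ _ _ _ (is_derive_partial_radial p x y i j)).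
Qed.

Lemma continuous_radial p x : continuous (fun z => p.[sqdist x z]).
Proof.
move=> y; apply: (@continuous_comp _ _ _ (sqdist x) (horner p)).
  exact: continuous_sqdist.
exact: continuous_horner.
Qed.

Lemma C2_on_radial (Omega : set 'rV[R]_n) p x :
  C2_on Omega (fun z => p.[sqdist x z]).
Proof.
have cont2 i : continuous (fun z : 'rV[R]_n => 2 * (z 0 i - x 0 i)).
  move=> y.
  exact: (@cvgM _ _ _ _ (fun=> 2 : R) _ _ _ (cvg_cst _) (@continuous_coordB _ _ i x y)).
split=> [y i _|i y j _]; split.
- exact: (@ex_derive _ _ _ _ _ _ _ (is_derive_radial p x y i)).
- rewrite partial_radial.
  exact: (cvgM (@continuous_radial p^`() x y) (cont2 i y)).
- rewrite partial_radial.
  exact: (@ex_derive _ _ _ _ _ _ _ (is_derive_partial_radial p x y i j)).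
- rewrite partial2_radial.
  exact: (cvgD (cvgM (cvgM (@continuous_radial p^`(2) x y) (cont2 j y)) (cont2 i y))
    (cvgM (@continuous_radial p^`() x y) (@cvg_cst _ (2 * (i == j)%:R : R) _ _ _))).
Qed.

Lemma grad_radial p x y :
  grad (fun z => p.[sqdist x z]) y = (2 * p^`().[sqdist x y]) *: (y - x).
Proof. by apply/rowP => i; rewrite !mxE partial_radial; ring. Qed.

Lemma edotZl (a : R) x y : edot (a *: x) y = a * edot x y.
Proof.
by rewrite /edot mulr_sumr; apply: eq_bigr => i _; rewrite mxE mulrA.
Qed.

Lemma edotZr (a : R) x y : edot x (a *: y) = a * edot x y.
Proof.
by rewrite /edot mulr_sumr; apply: eq_bigr => i _; rewrite mxE; ring.
Qed.

(** The Hessian is a multiple of the identity plus a multiple of the rank-one matrix built on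
    [y - x], so [y - x] is an eigenvector. Its eigenvalue is the second derivative of [p.[s ^+ 2]]
    in [s = enorm (y - x)]. *)
Lemma mul_hess_radial p x y :
  (y - x) *m hess (fun z => p.[sqdist x z]) y =
  (2 * p^`().[sqdist x y] + 4 * sqdist x y * p^`(2).[sqdist x y]) *: (y - x).
Proof.
apply/rowP => j; rewrite mxE [RHS]mxE [RHS]mulrDl.
under eq_bigr do rewrite [hess _ _ _ _]mxE partial2_radial mulrDr.
rewrite big_split /= [LHS]addrC; congr (_ + _).
  rewrite (bigD1 j) //= big1 ?addr0 => [|i /negPf ->]; last by rewrite /= !mulr0.
  by rewrite !mxE eqxx /=; ring.
set q := p^`(2).[_]; rewrite /sqdist /edot mulr_sumr !mulr_suml.
by apply: eq_bigr => i _; rewrite !mxE; ring.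
Qed.

Lemma enormZ (a : R) x : enorm (a *: x) = `|a| * enorm x.
Proof.
by rewrite /enorm edotZl edotZr mulrA -expr2 sqrtrM ?sqr_ge0 // sqrtr_sqr.
Qed.

Lemma inf_lap_radial (beta : R) p x y :
  let g := 2 * p^`().[sqdist x y] * enorm (y - x) in
  0 < g ->
  enorm (grad (fun z => p.[sqdist x z]) y) = g /\
  inf_lap beta (grad (fun z => p.[sqdist x z]) y) (hess (fun z => p.[sqdist x z]) y)
  = g `^ (- beta) *
    (g ^+ 2 * (2 * p^`().[sqdist x y] + 4 * sqdist x y * p^`(2).[sqdist x y])).
Proof.
move=> g g_gt0.
have d_ge0 : 0 <= enorm (y - x) by exact: sqrtr_ge0.
have p1_ge0 : 0 <= 2 * p^`().[sqdist x y].
  rewrite leNgt; apply/negP => p1_lt0.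
  by have := mulr_le0_ge0 (ltW p1_lt0) d_ge0; rewrite leNgt g_gt0.
have normE : enorm (grad (fun z => p.[sqdist x z]) y) = g.
  by rewrite grad_radial enormZ ger0_norm.
split=> //; rewrite /inf_lap normE; case: eqP => [grad0|_].
  move: g_gt0; rewrite -normE grad0 /enorm /edot big1 ?sqrtr0 ?ltxx // => i _.
  by rewrite mxE mul0r.
rewrite grad_radial -scalemxAl mul_hess_radial !(edotZl, edotZr).
have -> : edot (y - x) (y - x) = enorm (y - x) ^+ 2.
  by rewrite /enorm sqr_sqrtr // /edot sumr_ge0 // => i _; rewrite -expr2 sqr_ge0.
by rewrite /g; ring.
Qed.

End RadialPolynomial.

(** * Maxima of upper semicontinuous functions, and Euclidean balls *)

Lemma usc_compact_max {R : realType} {T : topologicalType} (K : set T) (h : T -> R) :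
  compact K -> K !=set0 ->
  (forall (x : T) (a : R), K x -> h x < a -> \forall y \near x, h y < a) ->
  exists2 x, K x & forall y, K y -> h y <= h x.
Proof.
move=> cptK [k0 Kk0] usch.
(* The superlevel sets of [h] at its own values are nested and nonempty, hence a filter base; any
   cluster point in [K] is a maximum point. *)
pose F : set_system T := filter_from K (fun y => K `&` [set z | h y <= h z]).
have properF : ProperFilter F.
  apply: filter_from_proper => [|y Ky]; last by exists y; split=> /=.
  apply: filter_from_filter => [|y z Ky Kz]; first by exists k0.
  have [hyz|/ltW hzy] := leP (h y) (h z).
    by exists z => // t [Kt /= hzt]; split; split=> //=; exact: le_trans hzt.
  by exists y => // t [Kt /= hyt]; split; split=> //=; exact: le_trans hyt.
have FK : F K by exists k0 => // t [].
have [p [Kp clFp]] := cptK F properF FK.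
(* If [h p < h y], semicontinuity gives a neighbourhood of [p] where [h < h y], yet it must meet the
   superlevel set of [y]. *)
exists p => // y Ky; rewrite leNgt; apply/negP => hpy.
have FBy : F (K `&` [set z | h y <= h z]) by exists y.
have [z [[_ /= hyz] /= hzy]] := clFp _ _ FBy (usch p (h y) Kp hpy).
by move: hyz; rewrite leNgt hzy.
Qed.

Section EuclideanBall.
Context {R : realType} {n : nat}.
Implicit Types (x y : 'rV[R]_n) (r : R).

Lemma edot_ge0 x : 0 <= edot x x.
Proof. by apply: sumr_ge0 => i _; rewrite -expr2 sqr_ge0. Qed.

Lemma enorm_ge0 x : 0 <= enorm x.
Proof. exact: sqrtr_ge0. Qed.

Lemma sqr_enorm x : enorm x ^+ 2 = edot x x.
Proof. by rewrite sqr_sqrtr ?edot_ge0. Qed.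

Lemma enorm0 : enorm (0 : 'rV[R]_n) = 0.
Proof. by rewrite /enorm /edot big1 ?sqrtr0 // => i _; rewrite mxE mul0r. Qed.

Lemma enormB x y : enorm (x - y) = enorm (y - x).
Proof. by rewrite -opprB -scaleN1r enormZ normrN1 mul1r. Qed.

(** This is the comparison that carries boundedness and neighbourhoods from the max norm of the
    topology to Euclidean balls. *)
Lemma mx_norm_le_enorm x : `|x| <= enorm x.
Proof.
rewrite [leLHS]/Num.norm /= mx_normrE; apply/bigmax_leP; split=> [|[i j] _].
  exact: enorm_ge0.
rewrite /= ord1 -(ger0_norm (enorm_ge0 x)) -ler_sqr ?nnegrE ?normr_ge0 //.
rewrite !real_normK ?num_real // sqr_enorm /edot (bigD1 j) //= -expr2 lerDl.
by apply: sumr_ge0 => k _; rewrite -expr2 sqr_ge0.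
Qed.

Lemma enorm_eq0 x : enorm x = 0 -> x = 0.
Proof.
by move=> x0; apply/normr0_eq0/eqP; rewrite eq_le normr_ge0 -{1}x0 mx_norm_le_enorm.
Qed.

Lemma continuous_edist x : continuous (fun y => enorm (y - x)).
Proof.
move=> y; apply: (@continuous_comp _ _ _ (sqdist x) Num.sqrt).
  exact: continuous_sqdist.
exact: sqrt_continuous.
Qed.

Lemma compact_eball x r : compact [set y | enorm (y - x) <= r].
Proof.
apply: bounded_closed_compact.
  exists (`|x| + r); split; first exact: num_real.
  move=> M ltM y /= yr; apply: le_trans (ltW ltM).
  rewrite -[y](subrK x) addrC; apply: le_trans (ler_normD _ _) _.
  by rewrite lerD2l; exact: le_trans (mx_norm_le_enorm _) yr.
apply: (@preimage_closed _ _ (fun y => enorm (y - x)) [set t | t <= r]).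
  by move=> ? _; exact: continuous_edist.
exact: closed_le.
Qed.

Lemma compact_eball_subset (K Omega : set 'rV[R]_n) :
  compact K -> open Omega -> K `<=` Omega ->
  exists2 r, 0 < r & forall x y, K x -> enorm (y - x) <= r -> Omega y.
Proof.
move=> /compact_near_coveringP cptK openO KO.
have : \forall r \near (0 : R)^'+,
    K `<=` (fun x => forall y, enorm (y - x) <= r -> Omega y).
  apply: (cptK R (0 : R)^'+ (fun r x => forall y, enorm (y - x) <= r -> Omega y)) => x Kx.
  have /nbhs_ballP[e /= e_gt0 xeO] : nbhs x Omega by apply: open_nbhs_nbhs; split=> //; exact: KO.
  (* Half of [e] absorbs the displacement of the centre from [x] to [z], the other half the radius
     [r]. *)
  exists (ball x (e / 2), [set r | r < e / 2]) => /=.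
    split; first by apply: nbhsx_ballx; rewrite divr_gt0.
    by apply: nbhs_right_lt; rewrite divr_gt0.
  move=> [z r] [/= xz re] y yzr; apply: xeO.
  rewrite (splitr e); apply: (ball_triangle xz).
  rewrite mx_norm_ball /ball_ /= distrC.
  exact: le_lt_trans (mx_norm_le_enorm _) (le_lt_trans yzr re).
move=> nearK; have [r [r_gt0 Kr]] : exists r : R, 0 < r /\
    (K `<=` fun x => forall y, enorm (y - x) <= r -> Omega y).
  near (0 : R)^'+ => r; exists r; split; near: r => //.
  exact: nbhs_right_gt.
by exists r => // x y Kx; exact: Kr.
Unshelve. all: by end_near. Qed.

End EuclideanBall.

(** * Testing the inequality with a concave cone *)

(* The right-hand side is the third Taylor polynomial at [s0 ^+ 2] of the square
   root, evaluated at [s ^+ 2]: it has the same second derivative at [s0 ^+ 2]. *)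
Lemma cubic_above_sqrt {R : realType} (s s0 : R) : 0 <= s -> 0 < s0 ->
  s - s0 <= (s ^+ 2 - s0 ^+ 2) / (2 * s0) - (s ^+ 2 - s0 ^+ 2) ^+ 2 / (8 * s0 ^+ 3)
            + (s ^+ 2 - s0 ^+ 2) ^+ 3 / (16 * s0 ^+ 5).
Proof.
move=> s_ge0 s0_gt0; rewrite -subr_ge0.
have -> : (s ^+ 2 - s0 ^+ 2) / (2 * s0) - (s ^+ 2 - s0 ^+ 2) ^+ 2 / (8 * s0 ^+ 3)
    + (s ^+ 2 - s0 ^+ 2) ^+ 3 / (16 * s0 ^+ 5) - (s - s0)
  = (s - s0) ^+ 4 * (s ^+ 2 + 4 * s * s0 + 5 * s0 ^+ 2) / (16 * s0 ^+ 5).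
  by field; rewrite gt_eqF.
apply: divr_ge0; last by rewrite mulr_ge0 // exprn_ge0 // ltW.
rewrite mulr_ge0 //; first by rewrite (exprM _ 2 2) sqr_ge0.
by rewrite !addr_ge0 ?mulr_ge0 ?sqr_ge0 // ltW.
Qed.

Section TouchingCone.
Context {R : realType} {n : nat}.
Variables (Omega : set 'rV[R]_n) (beta m c1 c2 : R) (f : R -> R -> R) (v : 'rV[R]_n -> R).
Hypothesis visc : viscosity_solution Omega beta m c1 c2 f v.

(** At [y0] the test polynomial has slope [g] and radial second derivative [- (2 * B)], which yields
    the right-hand side. The sign of [A] matters because [A] multiplies the inequality of
    [cubic_above_sqrt]. *)
Lemma viscosity_concave_cone (A B g : R) (x y0 : 'rV[R]_n) :
  Omega y0 -> y0 != x -> 0 <= A -> g = A - 2 * B * enorm (y0 - x) -> 0 < g ->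
  (\forall y \near y0,
     v y - (A * enorm (y - x) - B * enorm (y - x) ^+ 2)
     <= v y0 - (A * enorm (y0 - x) - B * enorm (y0 - x) ^+ 2)) ->
  - c1 * g `^ m - c2 * f (enorm y0) (v y0) <= - (2 * B) * (g `^ (- beta) * g ^+ 2).
Proof.
move=> Oy0 y0x A_ge0; set s0 := enorm (y0 - x) => gE g_gt0 maxy0.
have s0_gt0 : 0 < s0.
  rewrite lt_neqAle enorm_ge0 andbT eq_sym; apply: contra_neq y0x => /enorm_eq0/eqP.
  by rewrite subr_eq0 => /eqP.
have t0E y : sqdist x y = enorm (y - x) ^+ 2 by rewrite sqr_enorm.
(* Coefficients, in powers of [t - s0 ^+ 2], of [A] times the cubic of [cubic_above_sqrt] minus
   [B * (t - s0 ^+ 2)]; the latter is already polynomial in the squared distance. *)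
pose b1 := A / (2 * s0) - B.
pose b2 := - A / (8 * s0 ^+ 3).
pose b3 := A / (16 * s0 ^+ 5).
(* [Z] stays opaque, so differentiation and evaluation use only these two facts. *)
have [Z [Z1 Zt]] : exists Z : {poly R}, Z^`() = 1 /\ forall t, Z.[t] = t - s0 ^+ 2.
  by exists ('X - (s0 ^+ 2)%:P); rewrite derivXsubC; split=> // t; rewrite hornerXsubC.
pose q : {poly R} := (v y0)%:P + b1 *: Z + b2 *: Z ^+ 2 + b3 *: Z ^+ 3.
have q0 t : q.[t] = v y0 + b1 * (t - s0 ^+ 2) + b2 * (t - s0 ^+ 2) ^+ 2
                    + b3 * (t - s0 ^+ 2) ^+ 3.
  by rewrite /q !(hornerD, hornerZ, horner_exp, hornerC, Zt).
have dq : q^`() = b1%:P + (2 * b2) *: Z + (3 * b3) *: Z ^+ 2.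
  rewrite /q !derivD !derivZ derivC !deriv_exp Z1 add0r /= expr1 !mul1r alg_polyC.
  rewrite -[Z *+ 2]scaler_nat -[Z ^+ 2 *+ 3]scaler_nat !scalerA.
  by rewrite (mulrC b2) (mulrC b3).
have q1 : q^`().[s0 ^+ 2] = b1.
  rewrite dq !(hornerD, hornerZ, horner_exp, hornerC, Zt) subrr; ring.
have q2 : q^`(2).[s0 ^+ 2] = 2 * b2.
  rewrite derivnS derivn1 dq !derivD !derivZ derivC deriv_exp Z1.
  rewrite !(hornerD, hornerZ, horner_exp, hornerC, hornerMn, hornerM, Zt) subrr /=.
  ring.
have gradE : 2 * q^`().[sqdist x y0] * enorm (y0 - x) = g.
  by rewrite t0E -/s0 q1 /b1 gE; field; rewrite gt_eqF.
have [normE lapE] := inf_lap_radial beta (p := q) (x := x) (y := y0) ltac:(by rewrite gradE).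
have := visc.2 (fun z => q.[sqdist x z]) y0 (C2_on_radial _ _ _) Oy0.
rewrite lapE normE gradE t0E -/s0 q1 q2.
(* The terms in [A] cancel: a linear cone has no second derivative along its rays. *)
have -> : 2 * b1 + 4 * s0 ^+ 2 * (2 * b2) = - (2 * B).
  by rewrite /b1 /b2; field; rewrite gt_eqF.
rewrite mulrA [_ * - (2 * B)]mulrC; apply.
  (* The polynomial lies above the cone shifted to the value [v y0] at [y0], with equality there, so
     the local maximum is inherited. *)
  apply: filterS maxy0 => y; rewrite !t0E -/s0 !q0 subrr.
  have := cubic_above_sqrt (enorm_ge0 (y - x)) s0_gt0.
  set s := enorm (y - x) => /(ler_wpM2l A_ge0) cub max_y.
  have : v y0 + (A * (s - s0) - B * (s ^+ 2 - s0 ^+ 2)) <= q.[s ^+ 2].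
    rewrite q0 -!addrA lerD2l.
    apply: (le_trans (lerB cub (lexx _))); rewrite le_eqVlt; apply/orP; left; apply/eqP.
    by rewrite /b1 /b2 /b3; field; rewrite gt_eqF.
  by rewrite q0; lra.
by rewrite q0 subrr; ring.
Qed.

End TouchingCone.

(** * The strict barrier and the one-sided cone bound *)

Lemma barrier_strict_supersolution {R : realType} (beta m c1 c2 F fx A g : R) :
  0 <= beta <= 2 -> 0 <= c1 -> 0 <= c2 -> m <= 3 - beta -> 0 <= F -> fx <= F ->
  1 <= g <= A ->
  - (c1 * A + c2 * F + 1) * (g `^ (- beta) * g ^+ 2) < - c1 * g `^ m - c2 * fx.
Proof.
move=> /andP[beta_ge0 beta_le2] c1_ge0 c2_ge0 m_le F_ge0 fxF /andP[g_ge1 gA].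
have g_gt0 : 0 < g by lra.
have sub_powR : g `^ (- beta) * g ^+ 2 = g `^ (2 - beta).
  by rewrite -powR_mulrn ?ltW // -powRD ?(gt_eqF g_gt0) ?implybT // addrC.
rewrite sub_powR; set G := g `^ (2 - beta).
(* As [beta <= 2] and [1 <= g], the factor [G] absorbs the source term [c2 * F]. The summand 1 of
   the coefficient then makes the inequality strict. *)
have G_ge1 : 1 <= G by rewrite -(powRr0 g) ler_powR //; lra.
have gm : g `^ m <= A * G.
  have gG : g * G = g `^ (3 - beta).
    rewrite /G -{1}[g]powRr1 ?ltW // -powRD ?(gt_eqF g_gt0) ?implybT //.
    by congr (_ `^ _); ring.
  by apply: (le_trans (ler_powR g_ge1 m_le)); rewrite -gG ler_wpM2r // ltW // powR_gt0.
have c1m := ler_wpM2l c1_ge0 gm.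
have c2f := ler_wpM2l c2_ge0 fxF.
have c2FG : c2 * F <= c2 * F * G by rewrite ler_peMr // mulr_ge0.
lra.
Qed.

Section LocalLipschitz.
Context {R : realType} {n : nat}.
Variables (Omega : set 'rV[R]_n) (beta m c1 c2 : R) (f : R -> R -> R) (v : 'rV[R]_n -> R).
Hypotheses (beta02 : 0 <= beta <= 2) (c1_ge0 : 0 <= c1) (c2_ge0 : 0 <= c2).
Hypotheses (m_le : m <= 3 - beta) (visc : viscosity_solution Omega beta m c1 c2 f v).
Variables (M F : R).
Hypotheses (F_ge0 : 0 <= F) (fF : forall y, Omega y -> f (enorm y) (v y) <= F).
Hypothesis vM : forall y, Omega y -> `|v y| <= M.

(** With [B] as below, [2 * B * r = r * c1 * A + r * (c2 * F + 1)]. The bound on [r * c1] makes the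
    first term at most [A / 2], the lower bound on [A] makes the second at most [A / 2 - 1], so the
    slope stays at least 1 up to radius [r]. The bound on [4 * M] serves on the sphere. *)
Lemma viscosity_cone_bound (r A : R) (x : 'rV[R]_n) :
  0 < r -> r * c1 <= 1 / 2 -> 2 + 2 * r * (c2 * F + 1) <= A -> 4 * M <= A * r ->
  (forall y, enorm (y - x) <= r -> Omega y) ->
  forall y, enorm (y - x) <= r -> v y - v x <= A * enorm (y - x).
Proof.
move=> r_gt0 rc1 Alow AM ballO.
pose B := (c1 * A + c2 * F + 1) / 2.
have c2F_ge0 : 0 <= c2 * F by rewrite mulr_ge0.
have A_ge2 : 2 <= A by apply: le_trans Alow; rewrite lerDl !mulr_ge0 ?addr_ge0 // ltW.
have B_ge0 : 0 <= B by rewrite divr_ge0 // !addr_ge0 // mulr_ge0 //; lra.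
have Br : 2 * B * r <= A - 1.
  have : r * c1 * A <= 1 / 2 * A by rewrite ler_wpM2r //; lra.
  by rewrite /B; lra.
pose w y := A * enorm (y - x) - B * enorm (y - x) ^+ 2.
have cont_w : continuous w.
  move=> y; have cs := @continuous_edist _ _ x y.
  exact: (@cvgB _ _ _ _ _ (fun y => A * enorm (y - x)) (fun y => B * enorm (y - x) ^+ 2)
    _ _ (cvgMl_tmp cs) (cvgMl_tmp (cvgM cs cs))).
have [y0 /= y0r max_y0] : exists2 y0, enorm (y0 - x) <= r &
    forall y, enorm (y - x) <= r -> v y - w y <= v y0 - w y0.
  apply: (@usc_compact_max _ _ [set y | enorm (y - x) <= r] (fun y => v y - w y)).
  - exact: compact_eball.
  - by exists x; rewrite /= subrr enorm0 ltW.
  (* Upper semicontinuity of [v - w]: half of the gap is given to [v], half to the continuous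
     [w]. *)
  move=> z a /= zr za; pose e := (a - (v z - w z)) / 2.
  have e_gt0 : 0 < e by rewrite divr_gt0 // subr_gt0.
  have vz : \forall y \near z, v y < v z + e by apply: visc.1; [exact: ballO|rewrite ltrDl].
  have wz : \forall y \near z, w z - e < w y by apply: cvgr_gt (cont_w z) _ _; lra.
  near=> y; have vy : v y < v z + e by near: y.
  have wy : w z - e < w y by near: y.
  by rewrite /e in vy wy; lra.
have Ox : Omega x by apply: ballO; rewrite subrr enorm0 ltW.
have wx : w x = 0 by rewrite /w subrr enorm0; ring.
(* Enough because [w y] is at most [A * enorm (y - x)]. *)
suff h0 : v y0 - w y0 <= v x.
  move=> y yr; have := le_trans (max_y0 y yr) h0.
  have : 0 <= B * enorm (y - x) ^+ 2 by rewrite mulr_ge0 ?sqr_ge0.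
  by rewrite /w; lra.
have [->|y0x] := eqVneq y0 x; first by rewrite wx subr0.
set s0 := enorm (y0 - x) in y0r *.
have s0_ge0 : 0 <= s0 by exact: enorm_ge0.
have [s0r|] := ltP s0 r; last first.
  move=> r_le; have s0E : s0 = r by apply/eqP; rewrite eq_le y0r r_le.
  (* On the sphere [w] is at least [A * r / 2], hence at least [2 * M], which dominates the
     oscillation of [v]. *)
  have : B * r * r <= A / 2 * r by rewrite ler_wpM2r ?ltW //; lra.
  have := vM Ox; have := vM (ballO _ y0r); rewrite !ler_norml.
  by rewrite /w -/s0 s0E; lra.
exfalso.
have Bs0 : 2 * B * s0 <= 2 * B * r by rewrite ler_wpM2l // mulr_ge0.
have Bs0_ge0 : 0 <= 2 * B * s0 by apply: mulr_ge0 => //; apply: mulr_ge0.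
pose g := A - 2 * B * s0.
have g1A : 1 <= g <= A by rewrite /g; lra.
have near_max : \forall y \near y0, v y - w y <= v y0 - w y0.
  have : \forall y \near y0, enorm (y - x) < r.
    by apply: cvgr_lt (@continuous_edist _ _ x y0) _ _.
  by apply: filterS => y /ltW; exact: max_y0.
have := viscosity_concave_cone visc (ballO _ y0r) y0x _ (erefl g) _ near_max.
have := barrier_strict_supersolution beta02 c1_ge0 c2_ge0 m_le F_ge0 (fF (ballO _ y0r)) g1A.
have -> : c1 * A + c2 * F + 1 = 2 * B by rewrite /B; field.
move=> strict visc_ineq; move: strict; apply/negP; rewrite -leNgt.
by apply: visc_ineq; lra.
Unshelve. all: by end_near. Qed.

End LocalLipschitz.

(** * Choice of the Lipschitz constant and conclusion *)

Theorem lemma3 (R : realType) (n : nat) (n_gt0 : (0 < n)%N)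
    (Omega : set 'rV[R]_n) (domOmega : is_domain Omega) :
  exists L : set 'rV[R]_n -> R -> R -> R -> R -> R,
  forall (beta : R) (f : R -> R -> R) (c1 c2 m : R) (v : 'rV[R]_n -> R),
    0 <= beta <= 2 ->
    (forall I : set R, compact I ->
       has_ubound [set f (enorm z.1) z.2 | z in Omega `*` I]) ->
    0 <= c1 -> 0 <= c2 ->
    0 < m <= 3 - beta ->
    (exists B : R, forall x : 'rV[R]_n, Omega x -> `|v x| <= B) ->
    viscosity_solution Omega beta m c1 c2 f v ->
    forall K : set 'rV[R]_n, compact K -> K `<=` Omega ->
      lipschitz_with K
        (L K c1 c2 (sup_norm Omega v) (f0_norm Omega f v)) v.
Proof.
have openO : open Omega by case: domOmega.
(* [L] must be a total function of [K], so a radius is chosen for every set; the value 1 is a dummy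
   for sets that are not compact subsets of [Omega]. *)
have /choice[rad radP] : forall K : set 'rV[R]_n, exists r : R, 0 < r /\
    (compact K -> K `<=` Omega -> forall x y, K x -> enorm (y - x) <= r -> Omega y).
  move=> K; have [[cptK KO]|nK] := pselect (compact K /\ K `<=` Omega).
    have [r r_gt0 Kr] := compact_eball_subset cptK openO KO.
    by exists r.
  by exists 1; split=> // cptK KO; case: nK.
(* The denominator [2 * c1 + 2] gives [r * c1 <= 1 / 2] and stays positive when [c1 = 0]. *)
pose rho K c1 := Num.min (rad K) (1 / (2 * c1 + 2)).
(* The sum of the two lower bounds that [viscosity_cone_bound] puts on [A]. The supremum of [f] may
   be negative, hence [Num.max F 0]. *)
exists (fun K c1 c2 M F => 4 * M / rho K c1 + 2
  + 2 * rho K c1 * (c2 * Num.max F 0 + 1)).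
move=> beta f c1 c2 m v beta02 f_bnd c1_ge0 c2_ge0 /andP[_ m_le] [B vB] visc K cptK KO.
have [rad_gt0 /(_ cptK KO) radO] := radP K.
set M := sup_norm Omega v; set F0 := f0_norm Omega f v; set r := rho K c1.
set A := (X in lipschitz_with K X v).
have c1_gt0 : 0 < 2 * c1 + 2 by lra.
have r_gt0 : 0 < r by rewrite lt_min rad_gt0 divr_gt0.
have r_rad : r <= rad K by rewrite ge_min lexx.
have rc1 : r * c1 <= 1 / 2.
  have : r <= 1 / (2 * c1 + 2) by rewrite ge_min lexx orbT.
  by rewrite ler_pdivlMr //; lra.
have vM y : Omega y -> `|v y| <= M.
  move=> Oy; apply: ub_le_sup; last by exists y.
  by exists B => _ [z Oz <-]; exact: vB.
have fF y : Omega y -> f (enorm y) (v y) <= Num.max F0 0.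
  move=> Oy; rewrite le_max; apply/orP; left; apply: ub_le_sup; last by exists y.
  (* The values of [v] lie in the compact interval from [- B] to [B], so the set defining [f0_norm]
     is bounded above and its [sup] is a genuine supremum. *)
  have [U fU] := f_bnd `[- B, B]%classic (@segment_compact _ _ _).
  exists U => _ [z Oz <-]; apply: fU; exists (z, v z) => //=; split=> //=.
  by rewrite in_itv /= -ler_norml vB.
have F_ge0 : 0 <= Num.max F0 0 by rewrite le_max lexx orbT.
have c2F_ge0 : 0 <= c2 * Num.max F0 0 by rewrite mulr_ge0.
have rest_ge0 : 0 <= 2 * r * (c2 * Num.max F0 0 + 1).
  by rewrite !mulr_ge0 ?addr_ge0 // ltW.
have lip_le x y : K x -> K y -> v y - v x <= A * enorm (y - x).
  move=> Kx Ky; have := vM _ (KO _ Kx); have := vM _ (KO _ Ky) => vy vx.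
  have M_ge0 : 0 <= M by exact: le_trans (normr_ge0 _) vx.
  have AM : 4 * M <= A * r.
    rewrite -ler_pdivrMr //; rewrite /A; lra.
  have Alow : 2 + 2 * r * (c2 * Num.max F0 0 + 1) <= A.
    have : 0 <= 4 * M / r by rewrite divr_ge0 ?mulr_ge0 // ltW.
    by rewrite /A; lra.
  have [yr|yr] := leP (enorm (y - x)) r.
    apply: (viscosity_cone_bound beta02 c1_ge0 c2_ge0 m_le visc F_ge0 fF vM
      r_gt0 rc1 Alow AM) => // z zr.
    exact: radO Kx (le_trans zr r_rad).
  (* For distant points the oscillation of [v], at most [2 * M], is below [A * r]; no path inside
     [Omega] is needed. *)
  have : A * r <= A * enorm (y - x) by rewrite ler_wpM2l ?ltW //; lra.
  by move: vx vy; rewrite !ler_norml; lra.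
(* Either point may serve as the vertex of the cone, so the one-sided bound gives both signs. *)
move=> x y Kx Ky; rewrite ler_norml.
have := lip_le x y Kx Ky; have := lip_le y x Ky Kx; rewrite (enormB y x).
by move=> h1 h2; apply/andP; split; lra.
Qed.
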